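(* Let $\mathcal G=(V_0,V_1,E,\{V\})$ be a connectivity game on a finite bipartite directed graph with $V=V_0\cup V_1$. Let $\{\mathcal G_k\}_{k\ge 0}$ be the sequence of derivative graphs of $\mathcal G$, and let $s$ be its stabilization point. Then $\mathcal G$ is forced-connected if and only if the directed graph $\mathcal G_s$ is strongly connected.
   Context: Connectivity game: $V_0,V_1$ are disjoint finite sets, $V=V_0\cup V_1$, $E\subseteq (V_0\times V_1)\cup(V_1\times V_0)$; vertices may have no outgoing edge. Write $E(v)=\{u:(v,u)\in E\}$, $E^{-1}(S)=\{u:(u,v)\in E\text{ for some }v\in S\}$. A token starts at some vertex; whenever the token is at $v\in V_\sigma$, player $\sigma\in\{0,1\}$ moves it to some vertex of $E(v)$. If a vertex $v$ with $E(v)=\emptyset$ is reached, player 1 wins. An infinite play is won by player 0 if every vertex of $V$ is visited infinitely often, and by player 1 otherwise. $\mathcal G$ is forced-connected if player 0 wins $\mathcal G$, i.e. has a winning strategy (strategies may depend on the history) from every starting vertex. For a directed graph $H$, $SCC(H)$ is the set of its strongly connected components: the maximal sets of mutually reachable vertices, singletons included. For $U\subseteq V_1$, $S\subseteq V$, $Force(U,S)=\{v\in (E^{-1}(S)\setminus S)\cap U: E(v)\subseteq S\}$ (with respect to the full edge set $E$). Derivatives: $F_0=\emptyset$, $U_0=V_1$, and $\mathcal G_0=(V,E_0)$, where $E_0$ is the set of all edges of $E$ starting in $V_0$. For $k>0$: $F_k=\bigcup_{S\in SCC(\mathcal G_{k-1})}Force(U_{k-1},S)$, $U_k=U_{k-1}\setminus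 F_k$, $E_k=E_{k-1}\cup\{(v,u)\in E: v\in F_k\}$, $\mathcal G_k=(V,E_k)$. The stabilization point $s$ is the least $k>0$ with $F_k=\emptyset$ (then $\mathcal G_i=\mathcal G_{k-1}$ for all $i\ge k$).
   Formalization: The graph is assumed not to have exactly one vertex: a one-vertex bipartite game has no edges, so player 0 loses at the dead end, although its derivative graph is trivially strongly connected. *)

(* Defs.v *)
From mathcomp Require Import all_boot.

Set Implicit Arguments.
Unset Strict Implicit.
Unset Printing Implicit Defensive.

(* A connectivity game whose vertex set is the whole finite type [V]; the
   winning condition [{V}] is built into [won_by_player0] below. *)
Record game (V : finType) := Game {
  V0 : {set V};
  V1 : {set V};
  edge : rel V;
  V0_V1_disjoint : [disjoint V0 & V1];
  V0_V1_cover : V0 :|: V1 = [set: V];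
  edge_bipartite : forall v u, edge v u ->
    (v \in V0) && (u \in V1) || (v \in V1) && (u \in V0)
}.

Section Plays.
Variables (V : finType) (G : game V).

Definition succs (v : V) : {set V} := [set u | edge G v u].

Definition preds (S : {set V}) : {set V} :=
  [set u | [exists v in S, edge G u v]].

(* [FinitePlay x p] is the sequence of vertices [x :: p]. *)
Inductive play : Type :=
  | FinitePlay of V & seq V
  | InfinitePlay of (nat -> V).

(* Plays are maximal: a finite play must end in a vertex without successors. *)
Definition play_from (v : V) (rho : play) : Prop :=
  match rho with
  | FinitePlay x p => [/\ x = v, path (edge G) x p & succs (last x p) = set0]
  | InfinitePlay r => r 0 = v /\ forall i, edge G (r i) (r i.+1)
  end.

Definition won_by_player0 (rho : play) : Prop :=
  match rho with
  | FinitePlay _ _ => False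
  | InfinitePlay r => forall v n, exists2 m, n <= m & r m = v
  end.

(* A strategy is given the nonempty sequence of all vertices visited so far,
   the current one being the last. *)
Definition strategy := seq V -> V.

Definition legal_strategy0 (sigma : strategy) : Prop :=
  forall (x : V) (p : seq V), path (edge G) x p ->
    last x p \in V0 G -> succs (last x p) != set0 ->
    sigma (x :: p) \in succs (last x p).

Definition consistent0 (sigma : strategy) (rho : play) : Prop :=
  match rho with
  | FinitePlay x p => forall i, i < size p -> nth x (x :: p) i \in V0 G ->
      nth x (x :: p) i.+1 = sigma (take i.+1 (x :: p))
  | InfinitePlay r => forall i, r i \in V0 G -> r i.+1 = sigma (mkseq r i.+1)
  end.

Definition winning_strategy0 (v : V) (sigma : strategy) : Prop :=
  legal_strategy0 sigma /\
  forall rho, play_from v rho -> consistent0 sigma rho -> won_by_player0 rho.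

Definition forced_connected : Prop :=
  forall v, exists sigma, winning_strategy0 v sigma.

End Plays.

Section StrongConnectivity.
Variables (V : finType) (e : rel V).

Definition mutually_reachable (S : {set V}) : bool :=
  [forall u in S, forall v in S, connect e u v].

Definition SCC : {set {set V}} := [set S | maxset mutually_reachable S].

(* Paths may have length 0: a one-vertex graph without edges is strongly
   connected, although player 0 loses the game played on it. *)
Definition strongly_connected : Prop := forall u v, connect e u v.

End StrongConnectivity.

Section Derivatives.
Variables (V : finType) (G : game V).

Definition Force (U S : {set V}) : {set V} :=
  [set v in (preds G S :\: S) :&: U | succs G v \subset S].

Record stage := Stage { stage_F : {set V}; stage_U : {set V}; stage_E : rel V }.

Definition next_stage (st : stage) : stage :=
  let F := \bigcup_(S in SCC (stage_E st)) Force (stage_U st) S in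
  Stage F (stage_U st :\: F)
    (fun v u => stage_E st v u || (v \in F) && edge G v u).

Fixpoint derivative (k : nat) : stage :=
  if k is k'.+1 then next_stage (derivative k')
  else Stage set0 (V1 G) (fun v u => (v \in V0 G) && edge G v u).

Definition der_F k : {set V} := stage_F (derivative k).
Definition der_U k : {set V} := stage_U (derivative k).

(* The edge relation of the [k]-th derivative graph. *)
Definition der_E k : rel V := stage_E (derivative k).

Lemma der_F_sub k : der_F k.+1 \subset der_U k.
Proof.
apply/bigcupsP => S _; apply/subsetP => v.
by rewrite !inE => /andP[/andP[]].
Qed.

Lemma stabilizes : exists k, (0 < k) && (der_F k == set0).
Proof.
have H n k : #|der_U k| <= n -> exists j, (0 < j) && (der_F j == set0).
  elim: n k => [|n IHn] k leU;
    case: (eqVneq (der_F k.+1) set0) => [F0|Fn0]; try by exists k.+1; rewrite F0 /=.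
    case/negP: Fn0; rewrite -subset0.
    by move: leU; rewrite leqn0 cards_eq0 => /eqP <-; apply: der_F_sub.
  apply: (IHn k.+1); rewrite -ltnS; apply: leq_trans leU.
  have -> : der_U k.+1 = der_U k :\: der_F k.+1 by [].
  rewrite cardsD (setIidPr (der_F_sub k)).
  have Fpos : 0 < #|der_F k.+1| by rewrite card_gt0.
  by rewrite ltn_subrL Fpos (leq_trans Fpos (subset_leq_card (der_F_sub k))).
exact: (H _ 0 (leqnn _)).
Qed.

Definition stabilization_point : nat := ex_minn stabilizes.

End Derivatives.

(* Main.v *)
(** Forward direction: let T be a source component of the final graph, and
    suppose T is not everything.  A vertex of player 1 which is still unforced
    and outside T has a successor outside T, as otherwise it would have been
    forced at the last stage.  Player 1 can therefore keep the token outside T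
    forever.

    Backward direction: by induction on k, every path of the k-th derivative
    can be simulated by player 0, in the sense that its origin lies in the
    attractor of its end.  If the final graph is strongly connected, every
    vertex attracts the whole graph, and player 0 chases all vertices in a
    round-robin fashion. *)

Require Import Defs.
From mathcomp Require Import all_boot.

(** Take [x] with the fewest ancestors. An ancestor [y] of [x] has all its ancestors among those of
    [x], so by minimality the two sets agree and [x] reaches [y]. Hence [anc x] is a component,
    closed under predecessors by construction. *)
Lemma source_component (V : finType) (e : rel V) :
  ~~ [forall x, forall y, connect e x y] ->
  exists T : {set V}, [/\ T \in SCC e, T != [set: V] &
    forall v u, e v u -> u \in T -> v \in T].
Proof.
move=> /forallPn[x0 nsc].
pose anc x := [set y | connect e y x].
case: (arg_minnP (fun x => #|anc x|) (isT : predT x0)) => x _ xmin.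
have back y : connect e y x -> connect e x y.
  move=> yx.
  have sub : anc y \subset anc x.
    by apply/subsetP => z; rewrite !inE => zy; apply: connect_trans zy yx.
  have /eqP eqyx : anc y == anc x by rewrite eqEcard sub xmin.
  by have /setP/(_ x) := eqyx; rewrite !inE connect0.
have mutual : mutually_reachable e (anc x).
  apply/forall_inP => u; rewrite inE => ux; apply/forall_inP => v.
  by rewrite inE => /back; apply: connect_trans.
exists (anc x); split.
- rewrite inE; apply/maxsetP; split=> // B Bmut sub.
  apply/eqP; rewrite eqEsubset sub andbT; apply/subsetP => u uB.
  have xB : x \in B by rewrite (subsetP sub)// inE.
  by rewrite inE (forall_inP (forall_inP Bmut u uB)).
- apply: contra nsc => /eqP ancT; apply/forallP => y.
  by apply: (forall_inP (forall_inP mutual _ _)); rewrite ancT inE.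
- by move=> v u vu; rewrite !inE; apply: connect_trans; apply: connect1.
Qed.

Section Game.
Variables (V : finType) (G : game V).
Implicit Types (v u t x : V) (S T X : {set V}).

Lemma notin_V0 v : (v \notin V0 G) = (v \in V1 G).
Proof.
have := V0_V1_cover G; have := V0_V1_disjoint G => /pred0P/(_ v) /= dis.
move/setP/(_ v); rewrite !inE.
by move: dis; case: (v \in V0 G); case: (v \in V1 G).
Qed.

Lemma der_E_edge k v u : der_E G k v u -> edge G v u.
Proof. by elim: k => [|k IHk] /=; [case/andP | case/orP => [|/andP[]]]. Qed.

(** Edges enter the derivatives all at once per origin: at stage 0 for player 0, and at the moment
    of forcing for player 1. *)
Lemma der_E_unforced k v u : v \notin der_U G k -> der_E G k v u = edge G v u.
Proof.
elim: k => [|k IHk] /=.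
  by rewrite /der_U /= -notin_V0 negbK /der_E /= => ->.
rewrite /der_U /= in_setD negb_and negbK => /orP vU.
apply/idP/idP => [|vu]; first exact: (@der_E_edge k.+1).
rewrite /der_E /=; apply/orP.
case: vU => [vF|vU]; first by right; rewrite vF.
by left; rewrite -/(der_E G k v u) IHk.
Qed.

Lemma der_U_V1 k : der_U G k \subset V1 G.
Proof.
elim: k => [|k IHk]; first exact: subxx.
by apply: subset_trans IHk; apply: subsetDl.
Qed.

(** * Attractors of player 0 *)

(** Controllable predecessors: player 0 can enter [X] in one move. A dead end of player 1 is left
    out, since player 0 loses there. *)
Definition cpre X : {set V} :=
  [set v | if v \in V0 G then [exists u in X, edge G v u]
           else (succs G v != set0) && (succs G v \subset X)].

Lemma cpre_mono : {homo cpre : X Y / X \subset Y}.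
Proof.
move=> X Y XY; apply/subsetP => v; rewrite !inE.
case: ifP => _; last by case/andP => -> /subset_trans->.
case/exists_inP => u uX vu; apply/exists_inP; exists u => //.
exact: (subsetP XY).
Qed.

Definition attr_step t X := t |: cpre X.

Lemma attr_step_mono t : {homo attr_step t : X Y / X \subset Y}.
Proof. by move=> X Y XY; apply: setUS; apply: cpre_mono. Qed.

Definition attr t := fixset (attr_step t).

Definition rank t v := fix_order (attr_step t) v.

Lemma attrE t : attr t = t |: cpre (attr t).
Proof. by rewrite -[LHS](fixsetK (attr_step_mono t)). Qed.

Lemma attr_id t : t \in attr t.
Proof. by rewrite attrE setU11. Qed.

Lemma attr_cpre t : cpre (attr t) \subset attr t.
Proof. by rewrite {2}attrE subsetUr. Qed.

(** [attr t] contains [u] and is closed under [cpre], so it contains every iterate that builds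
    [attr u]. *)
Lemma attr_trans v u t : v \in attr u -> u \in attr t -> v \in attr t.
Proof.
move=> vu ut; apply: subsetP vu; rewrite [attr u]/attr /fixset.
elim: #|V| => [|n IHn] /=; first by rewrite sub0set.
rewrite subUset sub1set ut /=.
by apply: subset_trans (attr_cpre t); apply: cpre_mono.
Qed.

(** The rank is the iterate at which [v] enters the attractor, so [v] is a controllable predecessor
    of the iterate before, whose members all have smaller rank. *)
Lemma rank_cpre t v : v \in attr t -> v != t ->
  v \in cpre [set u | rank t u < rank t v].
Proof.
move=> vt neq; have mono := @attr_step_mono t.
have := in_iter_fix_orderE (attr_step t) v; rewrite -/(attr t) vt -/(rank t v).
case rk: (rank t v) => [|n] /=; first by rewrite inE.
rewrite in_setU1 (negPf neq) /=; apply: subsetP; apply: cpre_mono.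
by apply/subsetP => u; rewrite inE ltnS; apply: fix_order_small.
Qed.

(** A new edge from [v] to [u] starts at a forced vertex: all successors of [v] share a component of
    the previous graph with [u], so by induction each lies in [attr u], whichever one player 1
    picks. *)
Lemma connect_attr k v t : connect (der_E G k) v t -> v \in attr t.
Proof.
elim: k v t => [|k IHk] v t /connectP[p].
  elim: p v => [v _ ->|u p IHp v /= /andP[/andP[v0 vu] up] tE].
    exact: attr_id.
  apply: (subsetP (attr_cpre t)); rewrite inE v0.
  by apply/exists_inP; exists u => //; apply: IHp.
elim: p v => [v _ ->|u p IHp v /= /andP[vu up] tE]; first exact: attr_id.
apply: (attr_trans v u t _ (IHp u up tE)); move: vu; rewrite /der_E /=.
case/orP => [vu|/andP[/bigcupP[S]]]; first by apply: IHk; apply: connect1.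
rewrite inE => /maxsetp Smut; rewrite !inE => /andP[/andP[_ vU] sS] vu.
have uS : u \in S by rewrite (subsetP sS)// inE.
apply: (subsetP (attr_cpre u)); rewrite inE.
have sattr : succs G v \subset attr u.
  apply/subsetP => w /(subsetP sS) wS.
  by apply: IHk; apply: (forall_inP (forall_inP Smut w wS)).
case: ifP => _; last first.
  by rewrite sattr andbT; apply/set0Pn; exists u; rewrite inE.
by apply/exists_inP; exists u => //; apply: attr_id.
Qed.

(** * Chasing all vertices in cyclic order *)

Section RoundRobin.
Hypotheses (card_gt1 : 1 < #|V|) (attr_all : forall t v, v \in attr t).
Variable x0 : V.

Definition target c := nth x0 (enum V) (c %% #|V|).

Definition chase_step c x := if x == target c then c.+1 else c.

(* The number of targets reached along the history [h]. *)
Definition counter (h : seq V) := foldl chase_step 0 h.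

(** The counter already includes the current vertex, so a target just reached has been replaced by
    the next. The default is never taken at a vertex of player 0, by [chase_rank]. *)
Definition chase : strategy V := fun h =>
  let x := last x0 h in let t := target (counter h) in
  odflt x [pick u in succs G x | rank t u < rank t x].

Lemma counter_rcons h x : counter (rcons h x) = chase_step (counter h) x.
Proof. by rewrite /counter foldl_rcons. Qed.

Lemma targetS c : target c.+1 != target c.
Proof.
have N0 : 0 < #|V| by apply: ltnW.
rewrite /target nth_uniq ?enum_uniq -?cardE ?ltn_mod//.
rewrite -addn1 -[X in _ != X %% _]addn0 eqn_modDl mod0n modn_small//.
Qed.

Lemma target_fresh h x : x != target (counter (rcons h x)).
Proof.
rewrite counter_rcons /chase_step; case: ifP => [/eqP xt|/negbT//].
by rewrite [X in X != _]xt eq_sym targetS.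
Qed.

Lemma chase_rank h x (t := target (counter (rcons h x))) : x \in V0 G ->
  edge G x (chase (rcons h x)) && (rank t (chase (rcons h x)) < rank t x).
Proof.
move=> xV0; have := rank_cpre t x (attr_all t x) (target_fresh h x).
rewrite inE xV0 => /exists_inP[u]; rewrite inE => ru xu.
rewrite /chase last_rcons -/t; case: pickP => [w|/(_ u)]; rewrite !inE//=.
by rewrite xu ru.
Qed.

Lemma chase_legal : legal_strategy0 G chase.
Proof.
move=> x p _ lV0 _; rewrite inE.
by case: (lastP p) lV0 => [|q y]; rewrite ?last_rcons;
  [move/(chase_rank [::] x) | move/(chase_rank (x :: q) y)] => /andP[].
Qed.

Lemma succs_attr v : succs G v != set0.
Proof.
have [t neq] : exists t, v != t.
  have /card_gt0P[t] : 0 < #|predC1 v| by rewrite cardC1 -ltnS prednK// ltnW.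
  by exists t; rewrite eq_sym.
have := attr_all t v; rewrite attrE in_setU1 (negPf neq) inE /=.
case: ifP => _; last by case/andP.
by case/exists_inP => u _ vu; apply/set0Pn; exists u; rewrite inE.
Qed.

Section InfinitePlay.
Variable r : nat -> V.
Hypotheses (r_edge : forall i, edge G (r i) (r i.+1)).
Hypotheses (r_chase : forall i, r i \in V0 G -> r i.+1 = chase (mkseq r i.+1)).

Let c n := counter (mkseq r n.+1).

Lemma counterS n : c n.+1 = chase_step (c n) (r n.+1).
Proof. by rewrite /c mkseqS counter_rcons. Qed.

Lemma rank_decreases n :
  rank (target (c n)) (r n.+1) < rank (target (c n)) (r n).
Proof.
have [rV0|rV1] := boolP (r n \in V0 G).
  by rewrite r_chase// /c mkseqS; case/andP: (chase_rank (mkseq r n) _ rV0).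
have neq : r n != target (c n) by rewrite /c mkseqS target_fresh.
have := rank_cpre _ _ (attr_all _ _) neq; rewrite inE (negPf rV1) => /andP[_].
by move/subsetP/(_ (r n.+1)); rewrite !inE; apply.
Qed.

(** While the target stays the same, every move of either player lowers the rank with respect to it;
    induction on that rank. *)
Lemma target_reached n : exists m,
  [/\ n <= m, c m = c n, c m.+1 = (c n).+1 & r m.+1 = target (c n)].
Proof.
have [k] := ubnP (rank (target (c n)) (r n)); elim: k n => // k IHk n.
rewrite ltnS => rk; have := counterS n; rewrite /chase_step.
case: eqP => [rt cS|_ cS]; first by exists n.
have [|m [nm cm cm1 rm]] := IHk n.+1.
  by rewrite cS; apply: leq_trans rk; apply: rank_decreases.
by exists m; rewrite cm1 rm cm cS (ltnW nm).
Qed.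

Lemma counter_unbounded n j : exists2 m, n <= m & c m = c n + j.
Proof.
elim: j => [|j [m nm cm]]; first by exists n; rewrite ?addn0.
have [m' [mm' _ cm' _]] := target_reached m.
by exists m'.+1; [apply: leq_trans nm (leqW mm') | rewrite cm' cm addnS].
Qed.

Lemma chase_visits v n : exists2 m, n <= m & r m = v.
Proof.
have N0 : 0 < #|V| by apply: ltnW.
(* A counter value not below [c n] whose target is [v]: its residue modulo [#|V|] is the index of
   [v]. *)
pose C := c n * #|V| + index v (enum V).
have nC : c n <= C by apply: leq_trans (leq_addr _ _); rewrite leq_pmulr.
have [m nm cm] := counter_unbounded n (C - c n).
have [m' [mm' _ _ rm']] := target_reached m.
exists m'.+1; first exact: leq_trans nm (leqW mm').
rewrite rm' cm subnKC// /target /C modnMDl modn_small ?nth_index ?mem_enum//.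
by rewrite [X in _ < X]cardE index_mem mem_enum.
Qed.

End InfinitePlay.

Lemma chase_wins v : winning_strategy0 G v chase.
Proof.
split; first exact: chase_legal.
case=> [x p [_ _ /eqP]|r [_ r_edge] r_chase].
  by rewrite (negPf (succs_attr _)).
exact: chase_visits.
Qed.

End RoundRobin.

(** * A play that follows a strategy of player 0 but stays outside a set *)

Section Avoidance.
Variables (T : {set V}) (sigma : strategy V) (v0 : V).
Hypotheses (sigma_legal : legal_strategy0 G sigma) (v0T : v0 \notin T).
Hypothesis T_safe0 : forall v u,
  v \notin T -> v \in V0 G -> edge G v u -> u \notin T.
Hypothesis T_safe1 : forall v,
  v \notin T -> v \in V1 G -> succs G v != set0 -> ~~ (succs G v \subset T).

Definition avoid_move (h : seq V) :=
  let x := last v0 h in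
  if x \in V0 G then sigma h else odflt x [pick u in succs G x :\: T].

Fixpoint avoid_history n :=
  if n is n'.+1 then
    rcons (avoid_history n') (avoid_move (avoid_history n'))
  else [:: v0].

Definition avoid_play n := last v0 (avoid_history n).

Lemma avoid_historyE n : avoid_history n = mkseq avoid_play n.+1.
Proof.
elim: n => // n IHn; rewrite mkseqS -IHn /=; congr rcons.
by rewrite /avoid_play /= last_rcons.
Qed.

Lemma avoid_playS n : avoid_play n.+1 = avoid_move (mkseq avoid_play n.+1).
Proof. by rewrite /avoid_play /= last_rcons avoid_historyE. Qed.

Lemma avoid_play_sigma n : avoid_play n \in V0 G ->
  avoid_play n.+1 = sigma (mkseq avoid_play n.+1).
Proof. by rewrite avoid_playS /avoid_move mkseqS last_rcons => ->. Qed.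

(** Finite plays and legality split off the first vertex, while histories of infinite plays are
    given by [mkseq]; this passes between the two forms. *)
Lemma mkseq_cons (r : nat -> V) n :
  mkseq r n.+1 = r 0 :: mkseq (fun i => r i.+1) n.
Proof. by rewrite /mkseq /= (iotaDl 1 0) -map_comp. Qed.

Lemma path_mkseq (r : nat -> V) n :
  (forall i, i < n -> edge G (r i) (r i.+1)) ->
  path (edge G) (r 0) (mkseq (fun i => r i.+1) n).
Proof.
move=> e; apply/(pathP v0) => i; rewrite size_mkseq => ltin.
by rewrite -mkseq_cons !nth_mkseq ?e// ltnW.
Qed.

Lemma last_mkseq (r : nat -> V) n :
  last (r 0) (mkseq (fun i => r i.+1) n) = r n.
Proof.
by have := last_cons v0 (r 0) (mkseq (fun i => r i.+1) n);
  rewrite -mkseq_cons mkseqS last_rcons => <-.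
Qed.

Hypothesis sigma_wins : forall rho,
  play_from G v0 rho -> consistent0 G sigma rho -> won_by_player0 rho.

(** Legality of [sigma] only concerns histories that are paths, so the edges and the avoidance of
    [T] have to be established together, move by move. *)
Lemma avoid_step n :
  (forall i, i < n -> edge G (avoid_play i) (avoid_play i.+1)) ->
  avoid_play n \notin T ->
  edge G (avoid_play n) (avoid_play n.+1) /\ avoid_play n.+1 \notin T.
Proof.
set r := avoid_play => e rT; have pth := path_mkseq r n e.
(* A dead end would complete a finite play consistent with [sigma], which is lost for player 0. *)
have nonempty : succs G (r n) != set0.
  apply/negP => /eqP dead.
  apply: (sigma_wins (FinitePlay v0 (mkseq (fun i => r i.+1) n))).
    by split=> //; rewrite (last_mkseq r).
  move=> i; rewrite size_mkseq => ltin.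
  rewrite -[v0 in v0 :: _]/(r 0) -mkseq_cons.
  have ltin1 : i < n.+1 by rewrite ltnW.
  rewrite !nth_mkseq// /r => /avoid_play_sigma ->.
  by rewrite /mkseq -map_take take_iota (minn_idPl _).
have [rV0|rV1] := boolP (r n \in V0 G).
  have ern : edge G (r n) (r n.+1).
    rewrite /r avoid_play_sigma// mkseq_cons.
    by have := sigma_legal _ _ pth; rewrite last_mkseq inE => ->.
  by split=> //; apply: T_safe0 ern.
rewrite [r n.+1]avoid_playS /avoid_move mkseqS last_rcons -/r (negPf rV1).
case: pickP => [u|none] /=; first by rewrite !inE => /andP[-> ->].
rewrite notin_V0 in rV1.
have /subsetPn[u su uT] := T_safe1 _ rT rV1 nonempty.
by have := none u; rewrite in_setD uT su.
Qed.

Lemma avoid_play_edge n : edge G (avoid_play n) (avoid_play n.+1).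
Proof.
suff [e rT] : (forall i, i < n -> edge G (avoid_play i) (avoid_play i.+1)) /\
    avoid_play n \notin T by case: (avoid_step n e rT).
elim: n => // n [e rT]; have [en rT1] := avoid_step n e rT.
by split=> // i; rewrite ltnS leq_eqVlt => /orP[/eqP->//|]; apply: e.
Qed.

Lemma avoid_play_notin n : avoid_play n \notin T.
Proof.
elim: n => // n IHn.
by case: (avoid_step n (fun i _ => avoid_play_edge i) IHn).
Qed.

Lemma avoided_set0 : T = set0.
Proof.
apply/setP => t; rewrite inE; apply/negbTE/negP => tT.
have play : play_from G v0 (InfinitePlay avoid_play).
  by split=> // i; apply: avoid_play_edge.
have [m _ rm] := sigma_wins _ play avoid_play_sigma t 0.
by have := avoid_play_notin m; rewrite rm tT.
Qed.

End Avoidance.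

(** * The two directions of the equivalence *)

Lemma stable_source_safe k T v : der_F G k.+1 = set0 -> T \in SCC (der_E G k) ->
  v \notin T -> v \in der_U G k -> succs G v != set0 -> ~~ (succs G v \subset T).
Proof.
move=> F0 Tscc vT vU /set0Pn[u su]; apply/negP => sT.
suff : v \in der_F G k.+1 by rewrite F0 inE.
apply/bigcupP; exists T => //; rewrite !inE vT vU sT !andbT /=.
apply/exists_inP; exists u; first exact: (subsetP sT).
by move: su; rewrite inE.
Qed.

Lemma forced_connected_stable k : der_F G k.+1 = set0 ->
  forced_connected G -> strongly_connected (der_E G k).
Proof.
move=> F0 fc u v; apply: contraT => nuv.
have [|T [Tscc TV Tsource]] := @source_component V (der_E G k).
  by apply/forallPn; exists u; apply/forallPn; exists v.
have [w wT] : exists w, w \notin T.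
  have /subsetPn[w _ wT] : ~~ ([set: V] \subset T) by rewrite subTset.
  by exists w.
have [sigma [legal wins]] := fc w.
(* Such an [x] has all its edges in the derivative, and no edge of the derivative enters the source
   component [T]. *)
have closed x y : x \notin T -> x \notin der_U G k -> edge G x y -> y \notin T.
  by move=> xT xU xy; apply: contra xT; apply: Tsource; rewrite der_E_unforced.
have T0 : T = set0.
  apply: (avoided_set0 T sigma w legal wT) wins => [x y xT x0 xy|x xT x1 sx].
    apply: closed xy => //; apply: contraL x0 => xU; rewrite notin_V0.
    exact: subsetP (der_U_V1 k) _ xU.
  have [xU|xU] := boolP (x \in der_U G k); first exact: stable_source_safe xU sx.
  have /set0Pn[y sy] := sx; apply/subsetPn; exists y => //.
  by apply: closed xU _ => //; move: sy; rewrite inE.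
(* The empty set is not maximal, as any singleton is mutually reachable. *)
have := Tscc; rewrite T0 inE => /maxsetP[_ /(_ [set u])].
have mut : mutually_reachable (der_E G k) [set u].
  apply/forall_inP => x /set1P->; apply/forall_inP => y /set1P->.
  exact: connect0.
move=> /(_ mut (sub0set _)) /setP/(_ u).
by rewrite !inE eqxx.
Qed.

Lemma strongly_connected_forced k : 1 < #|V| ->
  strongly_connected (der_E G k) -> forced_connected G.
Proof.
move=> card_gt1 sc v; exists (chase v); apply: chase_wins => // t u.
exact: (connect_attr k).
Qed.

End Game.

Theorem theorem1 (V : finType) (G : game V) (hV : #|V| <> 1) :
  forced_connected G <-> strongly_connected (der_E G (stabilization_point G)).
Proof.
have [Vempty|V_gt0] := posnP #|V|.
  by split=> _ v; have := card0_eq Vempty v.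
have card_gt1 : 1 < #|V| by rewrite ltn_neqAle eq_sym V_gt0 andbT; apply/eqP.
split; last exact: strongly_connected_forced.
rewrite /stabilization_point; case: ex_minnP => -[//|k] /andP[_ /eqP F0] _ fc.
move=> u v.
(* The stabilization point is [k.+1]; nothing is forced there, so its graph has the same edges as
   that of stage [k]. *)
rewrite (_ : connect _ u v = connect (der_E G k) u v).
  exact: (forced_connected_stable _ _ _ F0 fc).
apply: eq_connect => x y; rewrite /der_E /= -/(derivative G k).
by move: F0; rewrite /der_F /= => ->; rewrite inE orbF.
Qed.
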